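(* Let $G$ be a countable amenable group and $(X,\mathcal{B},\mu,(T_{g})_{g\in G})$ be a mixing probability measure preserving system. Then there exists $A\in\mathcal{B}$ such that $$\mu(A\cap T_{g}A)>\mu(A)^{2}$$ for all $g\in G$.
   Context: A countable group $G$ is amenable if there exists a sequence of finite sets $(F_{N})_{N\in\mathbb{N}}$ in $G$ (called a Følner sequence) such that for any finite set $K\subseteq G$, $\lim_{N\to\infty}\frac{|KF_{N}\Delta F_{N}|}{|F_{N}|}=0$. A probability measure preserving system $(X,\mathcal{B},\mu,(T_{g})_{g\in G})$ consists of a probability space $(X,\mathcal{B},\mu)$ and a measure preserving action $(T_g)_{g\in G}$ of $G$ on it. It is mixing if for all $A\in\mathcal{B}$, $\lim_{g\to\infty}\mu(A\cap T_{g}A)=\mu(A)^{2}$, meaning that for any $\epsilon>0$ the set $\{g\in G\colon |\mu(A\cap T_{g}A)-\mu(A)^{2}|>\epsilon\}$ is finite. Measure spaces are assumed to be standard, that is, isomorphic mod $0$ to a disjoint union of a finite number of atoms with an interval equipped with the Lebesgue measure.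
   Formalization: The formal theorem also assumes that some measurable set has measure strictly between 0 and 1 and, if G is finite, that the action is not ergodic; without these the claim fails (one-point space; Z/2 swapping two equal atoms). *)

(* Defs.v *)
From HB Require Import structures.
From mathcomp Require Import all_boot all_order all_algebra.
From mathcomp Require Import finmap.
From mathcomp Require Import all_classical all_reals all_analysis.

Set Implicit Arguments.
Unset Strict Implicit.
Unset Printing Implicit Defensive.

Import Order.TTheory GRing.Theory Num.Theory.
Import numFieldNormedType.Exports.

Local Open Scope classical_set_scope.
Local Open Scope ring_scope.

Section Amenable.
Variables (R : realType) (G : groupType).

Definition fset_prod (K F : {fset G}) : {fset G} :=
  [fset (x * y)%g | x in K, y in F]%fset.

Definition fset_symdiff (A B : {fset G}) : {fset G} :=
  ((A `\` B) `|` (B `\` A))%fset.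

(* The sets F N must be nonempty for the quotients to make sense (here, a
   division by 0 would give 0), and K must be nonempty since for K = set0 the
   quotient is always 1. *)
Definition folner (F : nat -> {fset G}) : Prop :=
  (forall N, F N != fset0) /\
  forall K : {fset G}, K != fset0 ->
    (fun N => #|` fset_symdiff (fset_prod K (F N)) (F N)|%:R
              / #|` F N|%:R : R) @ \oo --> (0 : R).

Definition amenable : Prop := exists F : nat -> {fset G}, folner F.

End Amenable.

Section StandardSpace.
Variable R : realType.

(* f is a measure preserving map between the completions of the two measure
   spaces: the preimage of a measurable set E agrees, up to a negligible set,
   with a measurable set having the measure of E. *)
Definition measure_preserving_mod0 d1 d2
    (X : measurableType d1) (Y : measurableType d2)
    (mu : {measure set X -> \bar R}) (nu : {measure set Y -> \bar R})
    (f : X -> Y) : Prop :=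
  forall E : set Y, measurable E ->
    exists E' : set X,
      [/\ measurable E', mu.-negligible ((f @^-1` E) `+` E') & mu E' = nu E].

Definition isomorphic_mod0 d1 d2
    (X : measurableType d1) (Y : measurableType d2)
    (mu : {measure set X -> \bar R}) (nu : {measure set Y -> \bar R}) : Prop :=
  exists (f : X -> Y) (g : Y -> X),
    [/\ measure_preserving_mod0 mu nu f,
        measure_preserving_mod0 nu mu g,
        {ae mu, forall x, g (f x) = x} &
        {ae nu, forall y, f (g y) = y}].

(* The disjoint union of the interval [0, c] (null if c <= 0) with n atoms of
   masses w 0, ..., w n.-1, realized inside R by placing the atoms at the
   points -1, ..., -n. *)
Definition interval_with_atoms (c : R) (n : nat) (w : nat -> {nonneg R}) :
    {measure set (measurableTypeR R) -> \bar R} :=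
  measure_add
    (mrestr lebesgue_measure (measurable_itv `[0, c]))
    (msum (fun i => mscale (w i) (dirac (- i.+1%:R : measurableTypeR R))) n).

Definition standard_space d (X : measurableType d)
    (mu : {measure set X -> \bar R}) : Prop :=
  exists (c : R) (n : nat) (w : nat -> {nonneg R}),
    isomorphic_mod0 mu (interval_with_atoms c n w).

End StandardSpace.

Section Systems.
Variables (R : realType) (G : groupType) (d : measure_display).
Variables (X : measurableType d) (mu : probability X R) (T : G -> X -> X).

Record mp_action : Prop := MpAction {
  mp_action1 : forall x, T 1%g x = x;
  mp_actionM : forall g h x, T (g * h)%g x = T g (T h x);
  mp_action_measurable : forall g, measurable_fun setT (T g);
  mp_action_preserves :
    forall g A, measurable A -> mu (T g @^-1` A) = mu A }.

Definition mixing : Prop :=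
  forall A : set X, measurable A -> forall e : R, 0 < e ->
    finite_set [set g : G |
      (e%:E < `| mu (A `&` (T g @` A)) - mu A ^+ 2 |)%E].

Definition ergodic : Prop :=
  forall A : set X, measurable A -> (forall g, T g @` A = A) ->
    (mu A = 0 \/ mu A = 1)%E.

Definition nontrivial_space : Prop :=
  exists B : set X, measurable B /\ (0 < mu B < 1)%E.

End Systems.

(* Main.v *)
Require Import Defs.
From HB Require Import structures.
From mathcomp Require Import all_boot all_order all_algebra.
From mathcomp Require Import finmap.
From mathcomp Require Import all_classical all_reals all_analysis.
From mathcomp Require Import measurable_realfun.
From mathcomp Require Import zify lra.
Import Order.TTheory GRing.Theory Num.Theory.
Import numFieldNormedType.Exports.
Local Open Scope classical_set_scope.
Local Open Scope ring_scope.

(** The set A is built as an increasing union of sets A_n that grow by small,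
prescribed amounts d_n, each amount being half of the preceding one.  Two
opposite facts about a set D of small measure d drive the construction.

- Whatever D is, adjoining it to a set of measure at most s can lower the
  excess mu(A /\ T_g A) - mu(A)^2 by no more than about 2 s d, because the
  overlap can only grow: the loss is a small fraction of d, for every g at
  once, with no control on the speed of mixing.
- If D is almost invariant under a finite set L of group elements and mostly
  disjoint from A, adjoining it raises the overlap by a fixed fraction of d
  for every g in L.  The relation [gains g A B] records this effect; it is
  transitive and survives increasing unions.

By mixing, the excess of A_n is at least -d_n/32 outside a finite set L_n, and
the L_n can be chosen increasing with union G.  Once A_n and L_n are known,
A_(n+1) is chosen so that every g in L_n gains.  Take g in L_(n+1) but not in
L_n.  At stage n its excess is at worst barely negative; at stage n+1 it loses at
most a small fraction of d_n; from then on every step is a gain, and the next one alone is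
a fixed fraction of d_n/2, which dominates the earlier losses.  So the excess
of the union is positive at every g.

Almost invariant sets come from amenability by a layer-cake argument: for a
Folner set F and a tiny set D, the function counting the h in F with x in T_h D
is nearly invariant, hence so is one of its superlevel sets ([extension]).
Tiny sets exist because mixing with G infinite rules out atoms
([small_subset]).  Superlevel sets may be much smaller than d_n, so they are
accumulated by exhaustion until the measure is exactly right
([extension_of_measure]).

When G is finite, an invariant set of measure strictly between 0 and 1, which
exists by non-ergodicity, does the job. *)

(** * Real-valued probabilities and exhaustion *)

(** Values of a probability are finite, and working with them as reals makes
linear arithmetic available. *)
Definition prob {R : realType} {d : measure_display} {X : measurableType d}
    (mu : probability X R) (A : set X) : R := fine (mu A).

Section RealValuedMeasure.
Set Implicit Arguments.
Unset Strict Implicit.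
Unset Printing Implicit Defensive.
Context {R : realType} {d : measure_display} {X : measurableType d}.
Variable mu : probability X R.

Local Notation m := (prob mu).

Lemma fine_probK (A : set X) : measurable A -> (m A)%:E = mu A.
Proof. by move=> mA; rewrite fineK// fin_num_measure. Qed.

Lemma prob_ge0 (A : set X) : 0 <= m A.
Proof. exact: fine_ge0. Qed.

Lemma prob_le1 (A : set X) : measurable A -> m A <= 1.
Proof. by move=> mA; rewrite -lee_fin fine_probK// probability_le1. Qed.

Lemma le_prob (A B : set X) : measurable A -> measurable B ->
  A `<=` B -> m A <= m B.
Proof.
move=> mA mB AB; rewrite -lee_fin !fine_probK//.
by apply: le_measure; rewrite ?inE.
Qed.

Lemma probDI (A B : set X) : measurable A -> measurable B ->
  m A = m (A `\` B) + m (A `&` B).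
Proof.
move=> mA mB; apply: EFin_inj; rewrite EFinD !fine_probK//.
- exact: measureDI.
- exact: measurableI.
- exact: measurableD.
Qed.

Lemma probUD (A B : set X) : measurable A -> measurable B ->
  m (A `|` B) = m A + m (B `\` A).
Proof.
move=> mA mB; rewrite (@probDI (A `|` B) A)//; last exact: measurableU.
by rewrite setUK setDUl setDv set0U addrC.
Qed.

Lemma integrable_scaled_indic (c : R) (C : set X) : measurable C ->
  mu.-integrable setT (fun x => (c * \1_C x)%:E).
Proof.
move=> mC; under eq_fun do rewrite EFinM.
by apply: integrableZl => //; exact: integrable_indic.
Qed.

Lemma expectation_sum_indic (I : Type) (r : seq I) (a : I -> R)
    (A : I -> set X) : (forall i, measurable (A i)) ->
  (\int[mu]_x (\sum_(i <- r) a i * \1_(A i) x)%:E =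
   (\sum_(i <- r) a i * m (A i))%:E)%E.
Proof.
move=> mA; under eq_integral do rewrite -sumEFin.
rewrite integral_sum//; last first.
  by move=> i; exact: integrable_scaled_indic.
rewrite -sumEFin; apply: eq_bigr => i _.
under eq_integral do rewrite EFinM.
rewrite integralZl//; last exact: integrable_indic.
by rewrite integral_indic// setIT EFinM fine_probK.
Qed.

(** Every counting estimate below is an inequality between linear combinations
of indicators, integrated. *)
Lemma sum_prob_le (I J : Type) (r : seq I) (s : seq J) (a : I -> R) (b : J -> R)
    (A : I -> set X) (B : J -> set X) :
  (forall i, measurable (A i)) -> (forall j, measurable (B j)) ->
  (forall x, \sum_(i <- r) a i * \1_(A i) x <= \sum_(j <- s) b j * \1_(B j) x) ->
  \sum_(i <- r) a i * m (A i) <= \sum_(j <- s) b j * m (B j).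
Proof.
move=> mA mB AB; rewrite -lee_fin -!expectation_sum_indic//.
have int_sum K (t : seq K) (c : K -> R) (C : K -> set X) :
    (forall k, measurable (C k)) ->
    mu.-integrable setT (fun x => (\sum_(k <- t) c k * \1_(C k) x)%:E).
  move=> mC; under eq_fun do rewrite -sumEFin.
  by apply: integrable_sum => // k _; exact: integrable_scaled_indic.
apply: le_integral => //; [exact: int_sum|exact: int_sum|].
by move=> x _; rewrite lee_fin.
Qed.

Lemma count_prob_le (I J : Type) (r : seq I) (s : seq J)
    (A : I -> set X) (B : J -> set X) :
  (forall i, measurable (A i)) -> (forall j, measurable (B j)) ->
  (forall x, \sum_(i <- r) \1_(A i) x <= \sum_(j <- s) \1_(B j) x :> R) ->
  \sum_(i <- r) m (A i) <= \sum_(j <- s) m (B j).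
Proof.
move=> mA mB AB; under eq_bigr do rewrite -[m _]mul1r.
under [leRHS]eq_bigr do rewrite -[m _]mul1r.
apply: sum_prob_le => // x; under eq_bigr do rewrite mul1r.
by under [leRHS]eq_bigr do rewrite mul1r.
Qed.

Lemma bigcup_prob_approx (F : nat -> set X) (e : R) :
  (forall n, measurable (F n)) -> {homo F : p q / (p <= q)%N >-> p `<=` q} ->
  0 < e -> exists n, m (\bigcup_k F k) - e < m (F n).
Proof.
move=> mF ndF e0; have mU : measurable (\bigcup_k F k) by exact: bigcup_measurable.
have cv : (mu \o F) n @[n --> \oo] --> (m (\bigcup_k F k))%:E.
  rewrite fine_probK//; apply: nondecreasing_cvg_mu => // p q pq.
  by rewrite subsetEset; exact: ndF.
have /fine_cvgP[_ /cvgrPdist_lt/(_ _ e0)[N _ /(_ N (leqnn N))/=]] := cv.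
rewrite -/(m (F N)) => h; exists N.
by move: h; rewrite ltr_norml => /andP[_]; lra.
Qed.

(** Greedy exhaustion: each step realizes at least half of the increase still
possible, so the union of the steps admits no further increase and must have
reached [a]. *)
Lemma exhaustion (P : set X -> Prop) (C0 : set X) (a : R) :
  (forall C, P C -> measurable C) -> P C0 -> m C0 <= a ->
  (forall C, P C -> m C < a ->
    exists C', [/\ P C', C `<=` C', m C < m C' & m C' <= a]) ->
  (forall F : nat -> set X, (forall n, P (F n)) ->
    {homo F : p q / (p <= q)%N >-> p `<=` q} -> P (\bigcup_n F n)) ->
  exists C, P C /\ m C = a.
Proof.
move=> mP PC0 C0a grow limP.
pose ok C := P C /\ m C <= a.
have nextP C : exists C', ok C -> [/\ ok C', C `<=` C' &
    forall C'', ok C'' -> C `<=` C'' -> m C + m C'' <= 2 * m C'].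
  have [okC|] := pselect (ok C); last by exists C.
  pose S := [set m C'' | C'' in [set C'' | ok C'' /\ C `<=` C'']].
  have Sub : ubound S a by move=> _ [C'' [[_ ?] _] <-].
  have SC : S (m C) by exists C => //; split.
  have supS : has_sup S by split; [exists (m C)|exists a].
  have leS C'' : ok C'' -> C `<=` C'' -> m C'' <= sup S.
    by move=> okC'' CC''; apply: ub_le_sup; [exists a|exists C''].
  have [le|lt] := leP (sup S) (m C).
    exists C => _; split => // C'' okC'' CC''; have := leS _ okC'' CC''; lra.
  have e0 : 0 < (sup S - m C) / 2 by lra.
  have [_ [C' [okC' CC'] <-] hC'] := sup_adherent e0 supS.
  exists C' => _; split => // C'' okC'' CC''; have := leS _ okC'' CC''; lra.
have [next nextH] := choice nextP.
pose F n := iter n next C0.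
have okF n : ok (F n).
  by elim: n => [|n IH]; [split|have [] := nextH _ IH].
have stepF n : F n `<=` F n.+1 by have [] := nextH _ (okF n).
have homoF : {homo F : p q / (p <= q)%N >-> p `<=` q}.
  by apply: homo_leq stepF => [?|? ? ?]; [exact: subset_refl|exact: subset_trans].
have mF n : measurable (F n) by have [/mP] := okF n.
pose U := \bigcup_n F n.
have PU : P U by apply: limP => // n; have [] := okF n.
have mU := mP _ PU.
have FU n : F n `<=` U by exact: bigcup_sup.
have Ua : m U <= a.
  apply/ler_addgt0Pr => e e0; have [n] := bigcup_prob_approx mF homoF e0.
  have [_] := okF n; rewrite -/U; lra.
exists U; split => //; apply/eqP; rewrite eq_le Ua leNgt/=; apply/negP => Ult.
have [U' [PU' UU' ltU U'a]] := grow _ PU Ult.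
have e0 : 0 < m U' - m U by lra.
have [n] := bigcup_prob_approx mF homoF e0; rewrite -/U => Fn.
have [_ _ /(_ U')] := nextH _ (okF n).
have FU' : F n `<=` U' by exact: subset_trans (FU n) UU'.
move=> /(_ (conj PU' U'a) FU'); rewrite -/(F n.+1).
have : m (F n.+1) <= m U by exact: le_prob.
lra.
Qed.

End RealValuedMeasure.

(** * Folner sets *)

Section Folner.
Set Implicit Arguments.
Unset Strict Implicit.
Unset Printing Implicit Defensive.
Context {R : realType} {G : groupType}.

(** [B] is the boundary of the Folner set [F], that is, what [K] adds to it.
Taking the Folner property for [1 |` K] gives one boundary that serves all of
[K], and keeps the set of translating elements nonempty. *)
Lemma folner_invariant (K : {fset G}) (e : R) : amenable R G -> 0 < e ->
  exists F B : {fset G}, [/\ F != fset0, #|` B|%:R <= e * #|` F|%:R :> R,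
    [disjoint F & B]%fset &
    forall g h, g \in K -> h \in F -> (g * h)%g \in (F `|` B)%fset].
Proof.
move=> [F [F0 cvgF]] e0; pose K1 := (1%g |` K)%fset.
have K10 : K1 != fset0 by apply/fset0Pn; exists 1%g; rewrite !inE eqxx.
have /cvgrPdist_le/(_ _ e0)[N _ /(_ N (leqnn N))/=] := cvgF _ K10.
rewrite sub0r normrN ger0_norm; last by rewrite divr_ge0.
rewrite ler_pdivrMr; last by rewrite ltr0n cardfs_gt0 F0.
move=> sdF; exists (F N), (fset_prod K1 (F N) `\` F N)%fset; split => //.
- apply: le_trans sdF; rewrite ler_nat; apply: fsubset_leq_card.
  exact: fsubsetUl.
- by apply/fdisjointP => g gF; rewrite !inE gF.
move=> g h gK hF; rewrite !inE; case: (boolP ((g * h)%g \in F N)) => //= _.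
by apply/imfset2P; exists g; rewrite ?inE ?gK ?orbT//; exists h.
Qed.

End Folner.

Lemma sum_nat_ltn (q n : nat) : (\sum_(0 <= t < q) (t < n) = minn q n)%N.
Proof.
elim: q => [|q IH]; first by rewrite big_geq// min0n.
by rewrite big_nat_recr//= IH; lia.
Qed.

(** * Counting visits and their superlevel sets *)

Section Action.
Set Implicit Arguments.
Unset Strict Implicit.
Unset Printing Implicit Defensive.
Context {R : realType} {G : groupType} {d : measure_display}.
Context {X : measurableType d} {mu : probability X R} {T : G -> X -> X}.
Hypothesis T_action : mp_action mu T.

Local Notation m := (prob mu).

Lemma actionK g x : T g^-1%g (T g x) = x.
Proof. by rewrite -(mp_actionM T_action) mulVg (mp_action1 T_action). Qed.

Lemma actionVK g x : T g (T g^-1%g x) = x.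
Proof. by rewrite -(mp_actionM T_action) mulgV (mp_action1 T_action). Qed.

Lemma action_imageE g (A : set X) : T g @` A = T g^-1%g @^-1` A.
Proof.
apply/seteqP; split => [_ [x Ax <-]|x Ax]; first by rewrite /preimage/= actionK.
by exists (T g^-1%g x) => //; rewrite actionVK.
Qed.

Lemma mem_action_image g x (A : set X) :
  (x \in T g @` A) = (T g^-1%g x \in A).
Proof. by rewrite action_imageE; apply/idP/idP; rewrite !inE. Qed.

Lemma measurable_action_preimage g (A : set X) :
  measurable A -> measurable (T g @^-1` A).
Proof.
move=> mA; rewrite -[X in measurable X]setTI.
exact: (mp_action_measurable T_action).
Qed.

Lemma measurable_action_image g (A : set X) :
  measurable A -> measurable (T g @` A).
Proof. by rewrite action_imageE; exact: measurable_action_preimage. Qed.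

Lemma prob_action_image g (A : set X) : measurable A -> m (T g @` A) = m A.
Proof.
by move=> mA; rewrite /prob action_imageE (mp_action_preserves T_action).
Qed.

Lemma sum_prob_action_image (D : set X) (s : seq G) : measurable D ->
  \sum_(h <- s) m (T h @` D) = (size s)%:R * m D.
Proof.
move=> mD; under eq_bigr do rewrite prob_action_image//.
by rewrite big_const_seq count_predT iter_addr_0 mulr_natl.
Qed.

Definition visits (D : set X) (s : seq G) (x : X) : nat :=
  (\sum_(h <- s) (x \in T h @` D))%N.

Definition visit_level (D : set X) (s : seq G) (t : nat) : set X :=
  [set x | (t < visits D s x)%N].

Lemma visitsE (D : set X) (s : seq G) (x : X) :
  (visits D s x)%:R = \sum_(h <- s) \1_(T h @` D) x :> R.
Proof. by rewrite natr_sum; apply: eq_bigr => h _; rewrite indicE. Qed.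

Lemma measurable_visit_level D s t : measurable D ->
  measurable (visit_level D s t).
Proof.
move=> mD.
have -> : visit_level D s t =
    (fun x => \sum_(h <- s) \1_(T h @` D) x) @^-1` `]t%:R : R, +oo[.
  by apply/seteqP; split => x /=; rewrite in_itv/= andbT -visitsE ltr_nat.
rewrite -[X in measurable X]setTI; apply: measurable_sum => // h.
by apply/measurable_indicP; exact: measurable_action_image.
Qed.

(** The layer-cake formula, truncated at height [q]. *)
Lemma sum_visit_level (D : set X) (s : seq G) (q : nat) (x : X) :
  \sum_(0 <= t < q) \1_(visit_level D s t) x = (minn q (visits D s x))%:R :> R.
Proof.
rewrite -sum_nat_ltn natr_sum; apply: eq_bigr => t _; rewrite indicE.
congr ((nat_of_bool _)%:R); by apply/idP/idP; rewrite inE.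
Qed.

Lemma visits_size (D : set X) s x : (visits D s x <= size s)%N.
Proof.
rewrite /visits -sum1_size; apply: leq_sum => h _; exact: leq_b1.
Qed.

(** Translating by [g] turns the count along [F] into the count along [g F],
which is at most the count along [F] plus the count along the boundary [B]. *)
Lemma visit_level_shift (D : set X) (F B : {fset G}) (g : G) t :
  [disjoint F & B]%fset ->
  (forall h, h \in F -> (g * h)%g \in (F `|` B)%fset) ->
  T g @` visit_level D F t `\` visit_level D F t `<=`
  visit_level D (enum_fset F ++ enum_fset B) t `\` visit_level D F t.
Proof.
move=> FB gF x [gx ntx]; split => //; move: gx.
rewrite action_imageE /= /visit_level/= => /leq_trans; apply.
have -> : visits D F (T g^-1%g x) = visits D [seq (g * h)%g | h <- F] x.
  rewrite /visits big_map; apply: eq_bigr => h _.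
  by rewrite !mem_action_image invgM (mp_actionM T_action).
rewrite /visits; apply: (uniq_sub_le_big (le := leq)) => //.
- by move=> a b; exact: leq_addr.
- by rewrite map_inj_uniq ?fset_uniq//; exact: mulgI.
- rewrite cat_uniq !fset_uniq/= andbT; apply/hasPn => h /= hB.
  by apply/negP => hF; move/fdisjointP : FB => /(_ _ hF); rewrite hB.
- move=> _ /mapP[h hF ->]; have := gF _ hF.
  by rewrite inE mem_cat.
Qed.

(** * Small sets from mixing *)

Definition overlap (A : set X) (g : G) : R := m (A `&` (T g @` A)).

Lemma measurable_overlap A g : measurable A -> measurable (A `&` (T g @` A)).
Proof.
by move=> mA; apply: measurableI => //; exact: measurable_action_image.
Qed.

Lemma mixing_overlap (A : set X) (e : R) : mixing mu T -> measurable A ->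
  0 < e -> finite_set [set g | e < `|overlap A g - m A ^+ 2|].
Proof.
move=> mix mA e0; apply: sub_finite_set (mix A mA e e0) => g /=.
rewrite -(fine_probK mu mA) -(fine_probK mu (measurable_overlap g mA)).
by rewrite -EFinM -EFinB /= lte_fin expr2.
Qed.

(** Mixing excludes atoms: if 0 < m D < 1, then for all but finitely many [g]
the overlap of [D] with its translate has measure close to [m D ^+ 2], so it is
a non-null subset of [D] smaller by a definite factor.  Iterating shrinks the
measure geometrically. *)
Lemma small_subset (E : set X) (r : R) :
  infinite_set [set: G] -> mixing mu T -> nontrivial_space mu ->
  measurable E -> 0 < m E -> 0 < r ->
  exists D, [/\ measurable D, D `<=` E, 0 < m D & m D < r].
Proof.
move=> Ginf mix [B [mB]] Bnt mE E0 r0.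
have {Bnt} [B0 B1] : 0 < m B /\ m B < 1.
  by move: Bnt; rewrite -(fine_probK mu mB) !lte_fin => /andP[].
have [E' [mE' E'E E'0 E'1]] :
    exists E', [/\ measurable E', E' `<=` E, 0 < m E' & m E' < 1].
  have [E1|E1] := ltP (m E) 1; first by exists E; split.
  exists (E `&` B); split; [exact: measurableI|exact: subIsetl| |].
  - have := probUD mu mE mB; have := probDI mu mB mE.
    have := prob_le1 mu (measurableU _ _ mE mB).
    rewrite [B `&` E]setIC; lra.
  - apply: le_lt_trans B1; apply: le_prob => //; exact: measurableI.
(* m D ^+ 2 plus the error e below is at most m D * (1 + m D) / 2 <= c * m D *)
pose c := (1 + m E') / 2.
have [c0 c1] : 0 <= c /\ c < 1 by rewrite /c; split; lra.
have step n : exists D, [/\ measurable D, D `<=` E', 0 < m D & m D <= c ^+ n].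
  elim: n => [|n [D [mD DE' D0 Dn]]].
    by exists E'; split => //; rewrite expr0 ltW.
  have DE'm : m D <= m E' by exact: le_prob.
  pose e := m D * Num.min (m D / 2) ((1 - m D) / 2).
  have e0 : 0 < e by rewrite mulr_gt0// lt_min; apply/andP; split; lra.
  have [g ng] : exists g, ~ (e < `|overlap D g - m D ^+ 2|).
    apply/existsNP => all; apply: Ginf.
    apply: sub_finite_set (mixing_overlap mix mD e0) => g _; exact: all.
  move/negP: ng; rewrite -leNgt ler_norml => /andP[lo hi].
  have eD : e <= m D * (m D / 2) by rewrite ler_pM2l// ge_min lexx.
  have eD' : e <= m D * ((1 - m D) / 2) by rewrite ler_pM2l// ge_min lexx orbT.
  exists (D `&` (T g @` D)); split; first exact: measurable_overlap.
  - exact: subset_trans (@subIsetl _ _ _) DE'.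
  - have : 0 < m D * m D by rewrite mulr_gt0.
    rewrite -/(overlap D g); lra.
  rewrite -/(overlap D g) exprS.
  have : m D * (1 + m D) <= m D * (1 + m E') by rewrite ler_pM2l//; lra.
  have : c * m D <= c * c ^+ n by rewrite ler_wpM2l.
  rewrite /c; lra.
have /cvgrPdist_lt/(_ _ r0)[n _ /(_ n (leqnn n))/=] :
    (fun n => c ^+ n) @ \oo --> (0 : R).
  by apply: cvg_expr; rewrite ger0_norm.
rewrite sub0r normrN ger0_norm ?exprn_ge0// => cn.
have [D [mD DE' D0 Dn]] := step n.
by exists D; split => //; [exact: (subset_trans DE' E'E)|exact: (le_lt_trans Dn cn)].
Qed.

(** * Enlarging a set along a finite set of group elements *)

(** At least half of the measure added when passing from [A] to [B] shows up in
the overlap with the translate by [g].  The factor one half leaves room for the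
change in the squared measure, which for sets of small measure is a small
fraction of the measure added. *)
Definition gains (g : G) (A B : set X) : Prop :=
  overlap A g + (m B - m A) / 2 <= overlap B g.

Lemma gains_trans g A B C : gains g A B -> gains g B C -> gains g A C.
Proof. rewrite /gains; lra. Qed.

Lemma overlap_mono (A B : set X) g : measurable A -> measurable B ->
  A `<=` B -> overlap A g <= overlap B g.
Proof.
move=> mA mB AB; apply: le_prob; [exact: measurable_overlap..|].
by move=> x [Ax [y Ay yx]]; split; [exact: AB|exists y => //; exact: AB].
Qed.

(** The part of D /\ T_g D lying outside [C] contributes new overlap.  The
hypothesis makes both its defects small compared with [m D]: [W] bounds what
[D] loses by moving, and D /\ C what was already present. *)
Lemma gains_adjoin (g : G) (C D W : set X) :
  measurable C -> measurable D -> measurable W ->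
  T g @` D `\` D `<=` W ->
  4 * m W + 2 * m (D `&` C) <= m D -> gains g C (C `|` D).
Proof.
move=> mC mD mW DW small.
have mTD := measurable_action_image g mD.
have mDTD := measurable_overlap g mD; have mCTC := measurable_overlap g mC.
have le1 : m (C `&` (T g @` C)) +
    m ((D `&` (T g @` D)) `\` (C `&` (T g @` C))) <= overlap (C `|` D) g.
  rewrite -probUD//; apply: le_prob; [exact: measurableU|exact/measurable_overlap/measurableU|].
  move=> x [[Cx [y Cy yx]]|[Dx [y Dy yx]]]; split;
    by [left|exists y => //; left|right|exists y => //; right].
have le2 : m ((D `&` (T g @` D)) `\` C) <=
    m ((D `&` (T g @` D)) `\` (C `&` (T g @` C))).
  apply: le_prob; [exact: measurableD..|].
  by move=> x [Dx nCx]; split => // -[].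
have le3 : m ((D `&` (T g @` D)) `&` C) <= m (D `&` C).
  by apply: le_prob => //; [exact: measurableI|exact: measurableI|move=> x [[]]].
have le4 : m (T g @` D `\` D) <= m W by apply: le_prob => //; exact: measurableD.
have eq1 := probDI mu mDTD mC.
have eq2 := probDI mu mTD mD.
have eq3 := probUD mu mC mD.
have eq4 := probDI mu mD mC.
have eq5 := prob_action_image g mD.
rewrite [T g @` D `&` D]setIC in eq2.
rewrite /gains eq3; rewrite -/(overlap C g) in le1.
have := prob_ge0 mu W; have := prob_ge0 mu (D `&` C); lra.
Qed.

(** The points whose orbit along [s] spends at most a quarter of its time in
[C].  A set [D] of such points has translates along [s] that, on average, meet
[C] little, although no single translate is controlled. *)
Definition rare_hits (C : set X) (s : seq G) : set X :=
  [set x | \sum_(h <- s) \1_(T h @^-1` C) x <= (size s)%:R / 4 :> R].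

Lemma measurable_rare_hits (C : set X) (s : seq G) :
  measurable C -> measurable (rare_hits C s).
Proof.
move=> mC; have -> : rare_hits C s =
    (fun x => \sum_(h <- s) \1_(T h @^-1` C) x) @^-1` `]-oo, (size s)%:R / 4 : R].
  by rewrite preimage_itvNyc.
rewrite -[X in measurable X]setTI; apply: measurable_sum => // h.
by apply/measurable_indicP; exact: measurable_action_preimage.
Qed.

(** Markov's inequality: the expected proportion of hits is [m C]. *)
Lemma prob_rare_hits_gt0 (C : set X) (s : seq G) :
  measurable C -> m C < 4^-1 -> (0 < size s)%N -> 0 < m (rare_hits C s).
Proof.
move=> mC C4; rewrite -(ltr0n R) => s0; have mE := measurable_rare_hits s mC.
have mEc : measurable (~` rare_hits C s) by exact: measurableC.
have : \sum_(i <- [:: tt]) (size s)%:R / 4 * m (~` rare_hits C s) <=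
    \sum_(h <- s) 1 * m (T h @^-1` C).
  apply: (@sum_prob_le _ _ _ mu _ _ _ _ (fun=> (size s)%:R / 4) (fun=> 1)
           (fun=> ~` rare_hits C s) (fun h => T h @^-1` C)) => //.
    by move=> h; exact: measurable_action_preimage.
  move=> x; rewrite big_seq1; under [leRHS]eq_bigr do rewrite mul1r.
  rewrite indicE; case: (boolP (x \in ~` rare_hits C s)).
    by rewrite inE /rare_hits /= => /negP; rewrite -ltNge mulr1 => /ltW.
  by move=> _; rewrite mulr0; apply: sumr_ge0 => h _; rewrite indicE.
rewrite big_seq1.
under eq_bigr do
  rewrite mul1r /prob (mp_action_preserves T_action _ mC) -/(m C).
rewrite big_const_seq count_predT iter_addr_0 -[leRHS]mulr_natl => markov.
have := probDI mu (@measurableT _ X) mE.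
rewrite setTD setTI {1}/prob probability_setT /= => total.
have : m (~` rare_hits C s) / 4 <= m C by rewrite -(ler_pM2l s0); lra.
lra.
Qed.

Lemma sum_prob_visit_level (D : set X) (s : seq G) : measurable D ->
  \sum_(0 <= t < size s) m (visit_level D s t) = (size s)%:R * m D.
Proof.
move=> mD; rewrite -sum_prob_action_image//.
have mLv t : measurable (visit_level D s t) by exact: measurable_visit_level.
have mTD h : measurable (T h @` D) by exact: measurable_action_image.
apply/le_anti/andP; split; apply: count_prob_le => // x;
  by rewrite sum_visit_level -visitsE (minn_idPr (visits_size D s x)).
Qed.

(** With [s] a Folner set and [s'] its boundary, this bounds the total
displacement of the superlevel sets under translation. *)
Lemma sum_prob_visit_level_cat (D : set X) (s s' : seq G) (q : nat) :
  measurable D ->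
  \sum_(0 <= t < q) m (visit_level D (s ++ s') t `\` visit_level D s t) <=
  (size s')%:R * m D.
Proof.
move=> mD; rewrite -sum_prob_action_image//.
have mTD h : measurable (T h @` D) by exact: measurable_action_image.
apply: count_prob_le => // [t|x].
  by apply: measurableD; exact: measurable_visit_level.
have visits_cat : visits D (s ++ s') x = (visits D s x + visits D s' x)%N.
  by rewrite /visits big_cat.
rewrite -visitsE (eq_bigr (fun t => \1_(visit_level D (s ++ s') t) x -
    \1_(visit_level D s t) x)) => [|t _].
  rewrite sumrB !sum_visit_level visits_cat lerBlDr -natrD ler_nat; lia.
rewrite !indicE in_setD; case: (boolP (x \in visit_level D s t)) => xt.
  rewrite andbF; suff -> : x \in visit_level D (s ++ s') t by rewrite subrr.
  move: xt; rewrite !inE /visit_level /= visits_cat => /leq_trans; apply.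
  exact: leq_addr.
by rewrite andbT subr0.
Qed.

Lemma sum_prob_visit_levelI (D C : set X) (s : seq G) :
  measurable D -> measurable C -> D `<=` rare_hits C s ->
  \sum_(0 <= t < size s) m (visit_level D s t `&` C) <= (size s)%:R / 4 * m D.
Proof.
move=> mD mC DE.
have le1 : \sum_(0 <= t < size s) m (visit_level D s t `&` C) <=
    \sum_(h <- s) m ((T h @` D) `&` C).
  apply: count_prob_le => [t|h|x].
  - by apply: measurableI => //; exact: measurable_visit_level.
  - by apply: measurableI => //; exact: measurable_action_image.
  under eq_bigr do rewrite indicI; under [leRHS]eq_bigr do rewrite indicI.
  rewrite -!mulr_suml ler_wpM2r ?indicE// sum_visit_level -visitsE.
  by rewrite (minn_idPr (visits_size D s x)).
apply: (le_trans le1).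
have pullback h : m ((T h @` D) `&` C) = m (D `&` (T h @^-1` C)).
  rewrite /prob -(mp_action_preserves T_action h); last first.
    by apply: measurableI => //; exact: measurable_action_image.
  rewrite preimage_setI action_imageE -comp_preimage.
  congr (fine (mu (_ `&` _))).
  by apply/seteqP; split => x; rewrite /preimage/= actionK.
under eq_bigr do rewrite pullback -[m _]mul1r.
have -> : (size s)%:R / 4 * m D = \sum_(i <- [:: tt]) (size s)%:R / 4 * m D.
  by rewrite big_seq1.
apply: (@sum_prob_le _ _ _ mu _ _ _ _ (fun=> 1) (fun=> (size s)%:R / 4)
           (fun h => D `&` (T h @^-1` C)) (fun=> D)) => //.
  by move=> h; apply: measurableI => //; exact: measurable_action_preimage.
move=> x; rewrite big_seq1; under eq_bigr do rewrite mul1r indicI.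
rewrite -mulr_sumr indicE; case: (boolP (x \in D)).
  by rewrite inE mul1r mulr1 => /DE.
by rewrite mul0r mulr0.
Qed.

(** The candidates for the added piece are the superlevel sets [Lv t] of the
visit count of a tiny set [D] along a Folner set.  Summed over [t], their
displacements [W t] and their intersections with [C] are small compared with
their measures, so some single [t] is good in both respects at once; choosing
it by averaging is what makes overlaps between the translates of [D]
harmless. *)
Lemma extension (C : set X) (L : {fset G}) (r : R) :
  amenable R G -> infinite_set [set: G] -> mixing mu T -> nontrivial_space mu ->
  measurable C -> m C < 4^-1 -> 0 < r ->
  exists C', [/\ measurable C', C `<=` C', m C < m C', m C' <= m C + r &
    forall g, g \in L -> gains g C C'].
Proof.
move=> amen Ginf mix nt mC C4 r0.
have e0 : 0 < 16^-1 :> R by lra.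
have [F [B [F0 BF FB LF]]] := folner_invariant L amen e0.
pose q := #|` F|; have q0 : 0 < q%:R :> R by rewrite ltr0n cardfs_gt0.
have E0 : 0 < m (rare_hits C F) by apply: prob_rare_hits_gt0; rewrite -?(ltr0n R).
have rq0 : 0 < r / q%:R by rewrite divr_gt0.
have [D [mD DE D0 Dr]] :=
  small_subset Ginf mix nt (measurable_rare_hits F mC) E0 rq0.
pose Lv t := visit_level D F t.
pose W t := visit_level D (enum_fset F ++ enum_fset B) t `\` Lv t.
have mLv t : measurable (Lv t) by exact: measurable_visit_level.
have mW t : measurable (W t).
  by apply: measurableD => //; exact: measurable_visit_level.
have sumLv : \sum_(0 <= t < q) m (Lv t) = q%:R * m D.
  exact: sum_prob_visit_level.
have sumW : \sum_(0 <= t < q) m (W t) <= #|` B|%:R * m D.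
  exact: sum_prob_visit_level_cat.
have sumLvC : \sum_(0 <= t < q) m (Lv t `&` C) <= q%:R / 4 * m D.
  exact: sum_prob_visit_levelI.
have [t tq small] :
    exists2 t, (t < q)%N & 4 * m (W t) + 2 * m (Lv t `&` C) < m (Lv t).
  (* otherwise summing over t bounds q * m D by (4 / 16 + 2 / 4) * q * m D *)
  apply: contrapT => none.
  have : \sum_(0 <= t < q) m (Lv t) <=
      \sum_(0 <= t < q) (4 * m (W t) + 2 * m (Lv t `&` C)).
    rewrite !big_nat; apply: ler_sum => t /= tq.
    by rewrite leNgt; apply/negP => small; apply: none; exists t.
  rewrite big_split/= -!mulr_sumr sumLv.
  have qD0 : 0 < q%:R * m D by rewrite mulr_gt0.
  have : #|` B|%:R * m D <= 16^-1 * q%:R * m D by rewrite ler_pM2r.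
  rewrite mulrAC in sumLvC; lra.
have Lt0 : m (Lv t) <= q%:R * m D.
  rewrite -sumLv (bigD1_seq t) ?iota_uniq ?mem_index_iota//= lerDl.
  by apply: sumr_ge0 => i _; exact: prob_ge0.
have eqU := probUD mu mC (mLv t); have eqD := probDI mu (mLv t) mC.
have [Wt0 It0] : 0 <= m (W t) /\ 0 <= m (Lv t `&` C) by split; exact: prob_ge0.
exists (C `|` Lv t); split.
- exact: measurableU.
- exact: subsetUl.
- rewrite eqU; lra.
- have : q%:R * m D <= r by rewrite mulrC -ler_pdivlMr// ltW.
  rewrite eqU; lra.
move=> g gL; apply: (@gains_adjoin _ _ _ (W t)) => //; last exact: ltW.
by apply: visit_level_shift => // h; exact: LF.
Qed.

Lemma gains_bigcup (g : G) (A : set X) (F : nat -> set X) (N : nat) :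
  (forall n, measurable (F n)) -> {homo F : p q / (p <= q)%N >-> p `<=` q} ->
  (forall n, (N <= n)%N -> gains g A (F n)) -> gains g A (\bigcup_n F n).
Proof.
move=> mF homoF gF; have mU : measurable (\bigcup_n F n).
  exact: bigcup_measurable.
apply/ler_addgt0Pr => e e0; have [n] := bigcup_prob_approx mu mF homoF e0.
move=> Fn; have := gF _ (leq_maxl N n); rewrite /gains.
have : m (F n) <= m (F (maxn N n)).
  by apply: le_prob => //; apply: homoF; exact: leq_maxr.
have : overlap (F (maxn N n)) g <= overlap (\bigcup_n F n) g.
  by apply: overlap_mono => //; exact: bigcup_sup.
lra.
Qed.

(** The steps provided by [extension] have no lower bound on their size, since
the Folner set depends on [L]; exhaustion turns them into a step of the exact
size wanted. *)
Lemma extension_of_measure (A : set X) (L : {fset G}) (a : R) :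
  amenable R G -> infinite_set [set: G] -> mixing mu T -> nontrivial_space mu ->
  measurable A -> m A <= a -> a <= 4^-1 ->
  exists C, [/\ measurable C, A `<=` C, m C = a &
    forall g, g \in L -> gains g A C].
Proof.
move=> amen Ginf mix nt mA Aa a4.
pose P C := [/\ measurable C, A `<=` C & forall g, g \in L -> gains g A C].
have [|||||C [[mC AC gC] Ca]] := @exhaustion _ _ _ mu P A a.
- by move=> C [].
- by split => // g _; rewrite /gains subrr mul0r addr0.
- exact: Aa.
- move=> C [mC AC gC] Ca; have r0 : 0 < a - m C by rewrite subr_gt0.
  have C4 : m C < 4^-1 by exact: lt_le_trans a4.
  have [C' [mC' CC' ltC leC gC']] := extension L amen Ginf mix nt mC C4 r0.
  exists C'; split => //.
    split => //; first exact: subset_trans CC'.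
    by move=> g gL; exact: gains_trans (gC g gL) (gC' g gL).
  by move: leC; lra.
- move=> F PF homoF; split.
  + by apply: bigcup_measurable => n _; have [] := PF n.
  + have [_ AF _] := PF 0%N; exact: subset_trans AF (bigcup_sup _).
  + move=> g gL; apply: (@gains_bigcup _ _ _ 0%N) => // n; have [? ? h] := PF n => //.
    by move=> _; exact: h.
by exists C.
Qed.

(** * The over-recurrent set *)

(** Halving at each step keeps a step comparable with the preceding one, as
needed for a gain to repay the earlier loss, while the total, 1/64, is small
enough for the losses to be a small fraction of the increments. *)
Definition increment (n : nat) : R := 2^-1 ^+ n / 128.

Lemma over_recurrent_set :
  countable [set: G] -> amenable R G -> infinite_set [set: G] ->
  mixing mu T -> nontrivial_space mu ->
  exists A, measurable A /\ forall g, m A ^+ 2 < overlap A g.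
Proof.
move=> /countable_injP[f finj] amen Ginf mix nt.
have inc_gt0 n : 0 < increment n by rewrite /increment divr_gt0// exprn_gt0.
have incS n : increment n.+1 = increment n / 2 by rewrite /increment exprS; lra.
(* the increments from stage n on add up to 2 * increment n *)
pose size_ok n (p : set X * {fset G}) :=
  measurable p.1 /\ m p.1 = 64^-1 - 2 * increment n.
have nextP (np : nat * (set X * {fset G})) : exists p' : set X * {fset G},
    let: (n, p) := np in size_ok n p ->
    [/\ size_ok n.+1 p', p.1 `<=` p'.1,
        forall g, g \in p.2 -> gains g p.1 p'.1,
        forall g, g \in p.2 \/ (f g <= n)%N -> g \in p'.2 &
        forall g, g \notin p'.2 -> m p'.1 ^+ 2 - increment n.+1 / 32 <= overlap p'.1 g].
  move: np => [n [A L]].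
  have [[/= mA Am]|] := pselect (size_ok n (A, L)); last by exists (A, L).
  have [||C [mC AC Cm gC]] :=
    @extension_of_measure A L (64^-1 - 2 * increment n.+1) amen Ginf mix nt mA.
  - by rewrite Am incS; have := inc_gt0 n; lra.
  - by have := inc_gt0 n.+1; lra.
  have e0 : 0 < increment n.+1 / 32 by rewrite divr_gt0.
  have fin1 := mixing_overlap mix mC e0.
  have fin2 : finite_set (f @^-1` `I_n.+1).
    apply: finite_preimage; last exact: finite_II.
    by move=> x y _ _; apply: finj; rewrite inE.
  (* the three parts keep what was already handled, absorb the g with a bad
     excess, and make the sets L n exhaust G *)
  exists (C, L `|` fset_set [set g | increment n.+1 / 32 < `|overlap C g - m C ^+ 2|]
             `|` fset_set (f @^-1` `I_n.+1))%fset => _ /=; split => //.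
    move=> g h; rewrite !inE; case: h => [->//|fg].
    by rewrite [X in _ || X]in_fset_set// mem_set ?orbT.
  move=> g; rewrite !inE !negb_or => /andP[/andP[_ h] _]; move: h.
  rewrite in_fset_set// notin_setE /= => /negP.
  by rewrite -leNgt ler_norml => /andP[]; lra.
have [next nextH] := choice nextP.
pose st := fix st n := if n is k.+1 then next (k, st k) else (set0, fset0).
pose A n := (st n).1; pose L n := (st n).2.
have okst n : size_ok n (st n).
  elim: n => [|n IH]; last by have [] := nextH (n, st n) IH.
  by split => //=; rewrite /prob measure0 /increment expr0 /=; lra.
have mA n : measurable (A n) by have [] := okst n.
have Am n : m (A n) = 64^-1 - 2 * increment n by have [] := okst n.
have stepA n : A n `<=` A n.+1 by have [] := nextH (n, st n) (okst n).
have gA n g : g \in L n -> gains g (A n) (A n.+1).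
  by have [_ _ h _ _] := nextH (n, st n) (okst n); exact: h.
have LS n g : g \in L n \/ (f g <= n)%N -> g \in L n.+1.
  by have [_ _ _ h _] := nextH (n, st n) (okst n); exact: h.
have offL n g : g \notin L n -> m (A n) ^+ 2 - increment n / 32 <= overlap (A n) g.
  case: n => [_|n]; last by have [_ _ _ _ h] := nextH (n, st n) (okst n); exact: h.
  have -> : m (A 0%N) = 0 by rewrite /prob measure0.
  have : 0 <= overlap (A 0%N) g by exact: prob_ge0.
  by have := inc_gt0 0%N; rewrite expr0n/=; lra.
have homoA : {homo A : p q / (p <= q)%N >-> p `<=` q}.
  by apply: homo_leq stepA => [?|? ? ?]; [exact: subset_refl|exact: subset_trans].
pose U := \bigcup_n A n.
have mU : measurable U by exact: bigcup_measurable.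
exists U; split => // g.
have exL : exists n, g \in L n by exists (f g).+1; apply: LS; right.
(* n + 1 is the first stage that takes care of g *)
case: (ex_minnP exL) => -[|n] gL minL; first by rewrite /L inE in gL.
have gn : g \notin L n by apply/negP => /minL; rewrite ltnn.
have gU : gains g (A n.+1) U.
  apply: (@gains_bigcup _ _ _ n.+1) => // k.
  suff H j : g \in L (n.+1 + j)%N /\ gains g (A n.+1) (A (n.+1 + j)%N).
    by move=> /subnKC <-; have [] := H (k - n.+1)%N.
  elim: j => [|j [gLj gAj]].
    by rewrite addn0; split => //; rewrite /gains subrr mul0r addr0.
  rewrite addnS; split; first by apply: LS; left.
  exact: gains_trans gAj (gA _ _ gLj).
have lo := offL _ _ gn.
have mono : overlap (A n) g <= overlap (A n.+1) g by exact: overlap_mono.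
have U64 : m U <= 64^-1.
  apply/ler_addgt0Pr => e e0; have [k] := bigcup_prob_approx mu mA homoA e0.
  by rewrite -/U Am; have := inc_gt0 k; lra.
have Ulo : m (A n.+2) <= m U by apply: le_prob => //; exact: bigcup_sup.
(* with u = m (A n.+1), x = m U and D = increment n, the excess at g is at least
   (u - D) ^+ 2 - D / 32 + (x - u) / 2 - x ^+ 2, where x - u >= D / 2 and
   u <= x <= 64^-1 *)
move: gU lo Ulo; rewrite /gains !Am !incS.
have := inc_gt0 n; have : increment n <= 128^-1.
  rewrite /increment ler_pdivrMr// mulVf// exprn_ile1//; lra.
move: (increment n) (m U) U64 (overlap _ _) (overlap _ _) (overlap _ _) mono => D u u64 a b c.
nra.
Qed.

End Action.

Theorem theorem5p1 (R : realType) (G : groupType) (d : measure_display)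
    (X : measurableType d) (mu : probability X R) (T : G -> X -> X)
    (G_countable : countable [set: G])
    (G_amenable : amenable R G)
    (X_standard : standard_space mu)
    (T_action : mp_action mu T)
    (T_mixing : mixing mu T)
    (X_nontrivial : nontrivial_space mu)
    (finite_nonergodic : finite_set [set: G] -> ~ ergodic mu T) :
  exists A : set X, measurable A /\
    forall g : G, (mu A ^+ 2 < mu (A `&` (T g @` A)))%E.
Proof.
suff [A [mA overA]] : exists A, measurable A /\
    forall g, prob mu A ^+ 2 < overlap (mu := mu) (T := T) A g.
  exists A; split => // g.
  rewrite -(fine_probK mu mA) -(fine_probK mu (measurable_overlap T_action g mA)).
  by rewrite -EFin_expe lte_fin; exact: overA.
have [Gfin|Ginf] := pselect (finite_set [set: G]); last first.
  exact: over_recurrent_set.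
have /existsNP[A /not_implyP[mA /not_implyP[invA nA]]] := finite_nonergodic Gfin.
exists A; split => // g; rewrite /overlap invA setIid.
have A0 := prob_ge0 mu A; have A1 := prob_le1 mu mA.
have nA0 : prob mu A != 0.
  by apply/eqP => h; apply: nA; left; rewrite -fine_probK// h.
have nA1 : prob mu A != 1.
  by apply/eqP => h; apply: nA; right; rewrite -fine_probK// h.
by rewrite expr2 gtr_pMl lt_neqAle ?nA1 // eq_sym nA0.
Qed.
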